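(* Let $n_0\in\mathbb N_0$ and $n_j\in\mathbb N$ for $j\ge1$. Put $\hat D(S)=1+\sum_{j=0}^{S-1}n_j$ and $A(S)=2(2^{n_S-2}-1)$ for $S\in\mathbb N$. Let $M(S)$, $\widetilde N(S)$, $N(S)$, $c(S)$ $(S\in\mathbb N)$ be determined by the inputs $M(1)=2^{n_0}$, $\widetilde N(1)=0$, $c(1)=A(1)$ and, for $S\ge2$, the recurrences $$M(S)=M(S-1)+2^{\hat D(S-1)}c(S-1)x_0(S-1),\quad \widetilde N(S)=3\,y_0(S-1)\,c(S-1),\quad c(S)=-3\,y_0(S-1)\,c(S-1)+A(S),$$ together with $N(S)=\widetilde N(S)+2$. Then for all $S\in\mathbb N$: $$c(S)=A(S)+\sum_{j=1}^{S-1}(-3)^j\,A(S-j)\prod_{l=1}^{j}y_0(S-l),$$ $$\widetilde N(S)=A(S)-c(S)=-\sum_{j=1}^{S-1}(-3)^j\,A(S-j)\prod_{l=1}^{j}y_0(S-l),$$ $$N(S)=\widetilde N(S)+2,$$ $$M(S)=2^{n_0}+\sum_{j=1}^{S-1}R(S-j),\qquad\text{where } R(S)=2^{\hat D(S)}\,x_0(S)\,c(S).$$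
   Context: $\mathbb N=\{1,2,\dots\}$, $\mathbb N_0=\mathbb N\cup\{0\}$. For $m\in\mathbb N$ and $n\in\mathbb N_0$, $y_0(m,n)$ is the element of $\{1,\dots,3^m-1\}$ congruent to $\left(\frac{3^m+1}{2}\right)^{n+3^{m-1}}$ modulo $3^m$, and $x_0(m,n)=\frac{1+2^n y_0(m,n)}{3^m}$ (a positive integer). Abbreviations: $x_0(S)=x_0(S,n_S)$ and $y_0(S)=y_0(S,n_S)$. Empty sums are $0$. *)

(* Defs.v *)
From mathcomp Require Import all_boot all_order all_algebra.
From mathcomp Require Import ring zify.

Set Implicit Arguments.
Unset Strict Implicit.
Unset Printing Implicit Defensive.

Import Order.TTheory GRing.Theory Num.Theory.

(* Least nonnegative residue; by y0_bounds it lies in {1,...,3^m-1} for m >= 1. *)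
Definition y0 (m n : nat) : nat :=
  ((3 ^ m + 1) %/ 2) ^ (n + 3 ^ (m - 1)) %% 3 ^ m.

Lemma half_mul2 m : 2 * ((3 ^ m + 1) %/ 2) = 3 ^ m + 1.
Proof. by rewrite mulnC divnK // dvdn2 oddD oddX orbT. Qed.

Lemma y0_bounds m n : 0 < m -> 1 <= y0 m n <= 3 ^ m - 1.
Proof.
move=> m0; have gt1 : 1 < 3 ^ m by rewrite -[1](expn0 3) ltn_exp2l.
have lt : y0 m n < 3 ^ m by rewrite ltn_mod; apply: ltnW.
suff : y0 m n != 0 by lia.
have : coprime (2 * ((3 ^ m + 1) %/ 2)) (3 ^ m).
  by rewrite half_mul2 /coprime gcdnC gcdnDl gcdn1.
rewrite coprimeMl => /andP[_ /(coprimeXl (n + 3 ^ (m - 1)))].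
rewrite -coprime_modl -/(y0 m n) /coprime; apply: contraTneq => ->.
by rewrite gcd0n; lia.
Qed.

Lemma dvdn_1D2X_y0 m n : 0 < m -> 3 ^ m %| 1 + 2 ^ n * y0 m n.
Proof.
case: m => // m _; rewrite /y0 subn1 /=; set h := (3 ^ m.+1 + 1) %/ 2.
have half k : (2 * h) ^ k = 1 %[mod 3 ^ m.+1].
  by rewrite half_mul2 -modnXm modnDl modnXm exp1n.
have dvd1 k : 3 ^ k.+1 %| 2 ^ (3 ^ k) + 1.
  have e i : 2 ^ (3 ^ i.+1) = (2 ^ (3 ^ i)) ^ 3 by rewrite expnSr expnM.
  elim: k => // k; rewrite e; move: (2 ^ _) => a.
  move=> d; rewrite -(dvdn_addl (n := 3 * (a + 1) * (a + 1))); last first.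
    by rewrite dvdn_mulr // (expnS 3 k.+1); apply: dvdn_mul.
  have -> : a ^ 3 + 1 + 3 * (a + 1) * (a + 1) =
          3 * (a + 1) + (a + 1) * (a + 1) ^ 2.
    by ring.
  have d3 : 3 %| (a + 1) ^ 2.
    by rewrite Euclid_dvdX // (dvdn_trans _ d) // expnS dvdn_mulr.
  by rewrite dvdn_addl; [rewrite expnS | rewrite expnSr]; apply: dvdn_mul.
have cop : coprime (3 ^ m.+1) (2 ^ (3 ^ m)) by rewrite coprimeXl // coprimeXr.
have pull x : 3 ^ m.+1 %| 1 + 2 ^ n * (x %% 3 ^ m.+1) =
               (3 ^ m.+1 %| 1 + 2 ^ n * x).
  by rewrite /dvdn -modnDmr modnMmr modnDmr.
rewrite pull -(Gauss_dvdr _ cop) mulnDr muln1 mulnA -expnD addnC (addnC _ n).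
by rewrite -expnMn addnC /dvdn -modnDmr half modnDmr; apply: dvd1.
Qed.

Local Open Scope ring_scope.

Definition x0 (m n : nat) : rat := (1 + 2 ^+ n * (y0 m n)%:R) / 3 ^+ m.

Lemma x0_posnat m n : (0 < m)%N -> exists2 k : nat, (0 < k)%N & x0 m n = k%:R.
Proof.
move=> /(dvdn_1D2X_y0 n)/dvdnP[k e]; exists k; first by case: k e => //; lia.
have := congr1 (fun i => i%:R : rat) e.
rewrite /x0 natrD !natrM !natrX => ->.
by rewrite mulfK // expf_neq0.
Qed.

Definition Dhat (n : nat -> nat) (S : nat) : nat := (1 + \sum_(0 <= j < S) n j)%N.

(* The exponent n_S - 2 is an integer: it equals -1 when n_S = 1. *)
Definition A (n : nat -> nat) (S : nat) : rat := 2 * (2 ^ ((n S)%:Z - 2) - 1).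

Definition R (n : nat -> nat) (c : nat -> rat) (S : nat) : rat :=
  2 ^+ Dhat n S * x0 S (n S) * c S.

(* Main.v *)
Require Import Defs.
From mathcomp Require Import all_boot all_order all_algebra.
From mathcomp Require Import ring.

Import Order.TTheory GRing.Theory Num.Theory.
Local Open Scope ring_scope.

(** The recurrence for [c] is first-order, linear and inhomogeneous, with
multiplier [- 3 * y0(S)] and input [A(S)], so unrolling it gives a sum of the
inputs, each weighted by the product of the multipliers applied after it
([linear_recE]).  Extracting the powers of [- 3] from these products yields
the formula for [c].  The recurrences for [Nt] and [c] have opposite
homogeneous terms, so [Nt(S) = A(S) - c(S)], and the formula for [Nt] follows.
Finally [M] has increments [R(S)], so it telescopes ([telescope_rev]). *)

Lemma linear_recE (K : comNzRingType) (u a c : nat -> K) (k : nat) :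
  c 1%N = a 1%N ->
  (forall i, c i.+2 = u i.+1 * c i.+1 + a i.+2) ->
  c k.+1 = a k.+1
    + \sum_(1 <= j < k.+1) a (k.+1 - j)%N
        * \prod_(1 <= l < j.+1) u (k.+1 - l)%N.
Proof.
move=> c1 cS; elim: k => [|k IHk]; first by rewrite big_geq // addr0.
rewrite big_nat_recl // big_nat1 cS {}IHk addrC mulrDr big_distrr /= subn1.
rewrite [a k.+1 * _]mulrC; congr (_ + (_ + _)).
(* The term at lag j becomes the term at lag j + 1: one more factor, at l = 1. *)
apply: eq_bigr => j _.
by rewrite [in RHS]big_nat_recl // subn1 mulrCA.
Qed.

Lemma telescope_rev (V : zmodType) (f r : nat -> V) (k : nat) :
  (forall i, f i.+2 = f i.+1 + r i.+1) ->
  f k.+1 = f 1%N + \sum_(1 <= j < k.+1) r (k.+1 - j)%N.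
Proof.
move=> fS; elim: k => [|k IHk]; first by rewrite big_geq // addr0.
by rewrite big_nat_recl // fS {}IHk subn1 -addrA [r k.+1 + _]addrC.
Qed.

Theorem proposition8 (n : nat -> nat) (M Nt N c : nat -> rat)
  (hn : forall j : nat, (1 <= j)%N -> (1 <= n j)%N)
  (hM1 : M 1%N = 2 ^+ n 0%N)
  (hNt1 : Nt 1%N = 0)
  (hc1 : c 1%N = A n 1)
  (hM : forall S : nat, (2 <= S)%N ->
    M S = M (S - 1)%N
          + 2 ^+ Dhat n (S - 1) * c (S - 1)%N * x0 (S - 1) (n (S - 1)%N))
  (hNt : forall S : nat, (2 <= S)%N ->
    Nt S = 3 * (y0 (S - 1) (n (S - 1)%N))%:R * c (S - 1)%N)
  (hc : forall S : nat, (2 <= S)%N ->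
    c S = - 3 * (y0 (S - 1) (n (S - 1)%N))%:R * c (S - 1)%N + A n S)
  (hN : forall S : nat, (1 <= S)%N -> N S = Nt S + 2) :
  forall S : nat, (1 <= S)%N ->
    [/\ c S = A n S
              + \sum_(1 <= j < S) (- 3) ^+ j * A n (S - j)
                  * \prod_(1 <= l < j.+1) (y0 (S - l) (n (S - l)%N))%:R,
        Nt S = A n S - c S,
        A n S - c S
          = - \sum_(1 <= j < S) (- 3) ^+ j * A n (S - j)
                * \prod_(1 <= l < j.+1) (y0 (S - l) (n (S - l)%N))%:R,
        N S = Nt S + 2
      & M S = 2 ^+ n 0%N + \sum_(1 <= j < S) R n c (S - j)].
Proof.
case=> // k _.
have eqc : c k.+1 = A n k.+1
    + \sum_(1 <= j < k.+1) (- 3) ^+ j * A n (k.+1 - j)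
        * \prod_(1 <= l < j.+1) (y0 (k.+1 - l) (n (k.+1 - l)%N))%:R.
  have cS i : c i.+2 = - 3 * (y0 i.+1 (n i.+1))%:R * c i.+1 + A n i.+2.
    by rewrite hc // subn1.
  rewrite (linear_recE _ (fun i => - 3 * (y0 i (n i))%:R) (A n) c k hc1 cS).
  congr (_ + _); apply: eq_bigr => j _.
  by rewrite big_split /= prodr_const_nat subn1 mulrCA mulrA.
have eqNt : Nt k.+1 = A n k.+1 - c k.+1.
  case: k {eqc} => [|k]; first by rewrite hNt1 hc1 subrr.
  by rewrite hNt // (hc k.+2) // subn1 /=; ring.
split=> //; first by rewrite eqc; ring.
- exact: hN.
- rewrite -hM1; apply: telescope_rev => i.
  by rewrite hM // subn1 /R mulrAC.
Qed.
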